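(* Let $\mathcal{H}$ be a separable complex Hilbert space, let $\Lambda=\{\Lambda_i\}_{i\in J}$, $\Lambda_i\in\mathcal{L}(\mathcal{H},\mathcal{H}_i)$, be a g-frame for $\mathcal{H}$, let $G:\mathcal{H}\to\mathcal{H}$ be a bounded bijective linear operator and let $\Theta_i=\Lambda_iG$ for all $i\in J$, $\Theta=\{\Theta_i\}_{i\in J}$. Let $m=(m_i)_{i\in J}$ be a positive (resp. negative) semi-normalized sequence. Then $\Theta$ is a g-frame for $\mathcal{H}$ and the g-frame multiplier $M_{m,\Lambda,\Theta}$ is invertible on $\mathcal{H}$ with $$M_{m,\Lambda,\Theta}^{-1}=\begin{cases}G^{-1}S^{-1}_{(\sqrt{m_i}\Lambda_i)},&\text{when } m_i>0\ \text{for all } i,\\ -G^{-1}S^{-1}_{(\sqrt{|m_i|}\Lambda_i)},&\text{when } m_i<0\ \text{for all } i.\end{cases}$$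
   Context: $J\subseteq\mathbb{Z}$ is an index set, $\{\mathcal{H}_i\}_{i\in J}$ is a sequence of separable complex Hilbert spaces, and $\mathcal{L}(\mathcal{H},\mathcal{H}_i)$ is the set of bounded linear operators $\mathcal{H}\to\mathcal{H}_i$. A family $\{\Lambda_i\}_{i\in J}$, $\Lambda_i\in\mathcal{L}(\mathcal{H},\mathcal{H}_i)$, is a g-frame for $\mathcal{H}$ if there are $A,B>0$ with $A\|f\|^2\le\sum_{i\in J}\|\Lambda_if\|^2\le B\|f\|^2$ for all $f\in\mathcal{H}$; its g-frame operator is $S_{(\Lambda_i)}f=\sum_{i\in J}\Lambda_i^{\star}\Lambda_if$, a bounded, positive, invertible operator. $S_{(\sqrt{|m_i|}\Lambda_i)}$ denotes the g-frame operator of $\{\sqrt{|m_i|}\Lambda_i\}_{i\in J}$. The multiplier is $M_{m,\Lambda,\Theta}f=\sum_{i\in J}m_i\Lambda_i^{\star}\Theta_if$. A sequence $(m_i)$ is semi-normalized if there are $b\ge a>0$ with $a\le|m_i|\le b$ for all $i\in J$; it is positive (negative) if all $m_i$ are real and $>0$ ($<0$). *)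

(* Defs.v *)
From HB Require Import structures.
From mathcomp Require Import all_boot all_order all_algebra sesquilinear complex.
From mathcomp Require Import all_classical all_reals all_analysis.
From mathcomp.analysis.showcase Require summability.

Set Implicit Arguments.
Unset Strict Implicit.
Unset Printing Implicit Defensive.

Import Order.TTheory GRing.Theory Num.Theory.
Import numFieldNormedType.Exports.

Local Open Scope classical_set_scope.
Local Open Scope complex_scope.
Local Open Scope ring_scope.

(* The inner product is linear in its first argument and conjugate-linear in
   its second one. *)
HB.mixin Record CompleteNormedModule_isHilbert (R : realType) H
    of CompleteNormedModule R[i] H := {
  inner : {dot H for (@Num.conj R[i])} ;
  sqr_norm_inner : forall f : H, `|f| ^+ 2 = inner f f
}.

#[short(type="hilbertType")]
HB.structure Definition Hilbert (R : realType) :=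
  {H of CompleteNormedModule_isHilbert R H & CompleteNormedModule R[i] H}.

Definition separable (T : topologicalType) :=
  exists2 D : set T, countable D & dense D.

Section operators.
Context {R : realType}.
Implicit Types H K : hilbertType R.

(* The norm of a normed module over R[i] takes its values in R[i]; this is the
   same norm as an element of R. *)
Definition rnorm {H} (f : H) : R := complex.Re `|f|.

Definition bounded_linear {H K} (T : H -> K) :=
  linear T /\ exists C : R, forall f, rnorm (T f) <= C * rnorm f.

(* The adjoint of a bounded linear operator exists and is unique (Riesz); the
   default value 0 is only reached for other functions. *)
Definition adjoint {H K} (T : H -> K) (g : K) : H :=
  xget 0 [set h : H | forall f : H, inner (T f) g = inner f h].

(* A two-sided inverse of T whenever T is bijective. *)
Definition inverse {H} (T : H -> H) : H -> H := pinv setT T.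

Definition invertible {H} (T : H -> H) :=
  [/\ bounded_linear T, bijective T & bounded_linear (inverse T)].

End operators.

Section gframes.
Context {R : realType} {J : set int} {H : hilbertType R} {K : J -> hilbertType R}.
Implicit Types (Lambda Theta : forall i : J, H -> K i) (c m : J -> R[i]).

Definition gframe Lambda :=
  (forall i, bounded_linear (Lambda i)) /\
  exists A B : R, [/\ 0 < A, 0 < B & forall f : H,
    ((A * rnorm f ^+ 2)%:E <= \esum_(i in [set: J]) (rnorm (Lambda i f) ^+ 2)%:E
       <= (B * rnorm f ^+ 2)%:E)%E].

Definition scaled_family c Lambda : forall i : J, H -> K i :=
  fun i f => c i *: Lambda i f.

(* Vector-valued sums over J are limits of the net of finite partial sums,
   i.e. they are unconditional. *)
Definition gframe_operator Lambda (f : H) : H :=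
  summability.sum (fun i : J => adjoint (Lambda i) (Lambda i f)).

Definition gmultiplier_term m Lambda Theta (f : H) (i : J) : H :=
  m i *: adjoint (Lambda i) (Theta i f).

Definition gmultiplier m Lambda Theta (f : H) : H :=
  summability.sum (gmultiplier_term m Lambda Theta f).

Definition gmultiplier_converges m Lambda Theta :=
  forall f : H, cvg (summability.partial_sum (gmultiplier_term m Lambda Theta f)
                       @ summability.totally).

End gframes.

Section symbols.
Context {R : realType} {J : set int}.
Implicit Type m : J -> R[i].

Definition semi_normalized m := exists a b : R,
  [/\ 0 < a, a <= b & forall i, a%:C <= `|m i| <= b%:C].

(* In the order of R[i], 0 < z means that z is real and positive. *)
Definition positive_seq m := forall i, 0 < m i.
Definition negative_seq m := forall i, m i < 0.

End symbols.

(* Main.v *)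
(* Let Lambda' = (sqrt |m_i| Lambda_i), again a g-frame. Since
   |m_i| Lambda_i^* Lambda_i is the i-th term of the frame operator of Lambda',
   the multiplier is S_{Lambda'} o G up to the sign of m.
   The frame operator S of a g-frame converges unconditionally because the
   norm of a partial sum of S f is controlled by the corresponding partial sum
   of |Lambda_i f|^2; it is symmetric and coercive, hence bijective with bounded
   inverse by the Lax-Milgram lemma, which also yields adjoints (Riesz). The
   boundedness of G^-1 follows from the uniform boundedness principle: it makes
   G^* bounded below, so that G G^* is coercive. *)
Require Import Defs.
From mathcomp Require Import all_boot all_order all_algebra sesquilinear complex.
From mathcomp Require Import finmap.
From mathcomp Require Import all_classical all_reals all_analysis.
From mathcomp Require Import ring lra.
From mathcomp.analysis.showcase Require summability.

Set Implicit Arguments.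
Unset Strict Implicit.
Unset Printing Implicit Defensive.

Import Order.TTheory GRing.Theory Num.Theory.
Import numFieldNormedType.Exports.

Local Open Scope classical_set_scope.
Local Open Scope complex_scope.
Local Open Scope ring_scope.

(** * The underlying real inner product space, Cauchy-Schwarz and completeness *)

Section real_inner.
Context {R : realType} {H : hilbertType R}.
Implicit Types (f g h : H) (r : R).

(** The real part is a real inner product with the same norm. Estimates and minimization are carried
    out with it, since they need ordered scalars. *)
Definition rinner f g : R := complex.Re (inner f g).

Lemma rnormE f : `|f| = (rnorm f)%:C.
Proof. by rewrite /rnorm RRe_real // ger0_real. Qed.

Lemma rnorm_ge0 f : 0 <= rnorm f.
Proof. by rewrite -ler0c -rnormE. Qed.

Lemma rnorm0 : rnorm (0 : H) = 0.
Proof. by rewrite /rnorm normr0. Qed.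

Lemma rnorm_eq0 f : rnorm f = 0 -> f = 0.
Proof. by move=> f0; apply/eqP; rewrite -normr_eq0 rnormE f0. Qed.

Lemma rnormZ (c : R[i]) f : rnorm (c *: f) = complex.Re `|c| * rnorm f.
Proof.
by rewrite {1}/rnorm normrZ rnormE; case: `|c| => a b /=; rewrite mulr0 subr0.
Qed.

Lemma rnormZr r f : rnorm (r%:C *: f) = `|r| * rnorm f.
Proof. by rewrite rnormZ normc_def /= expr0n addr0 sqrtr_sqr. Qed.

Lemma rnormN f : rnorm (- f) = rnorm f.
Proof. by rewrite /rnorm normrN. Qed.

Lemma rdistC f g : rnorm (f - g) = rnorm (g - f).
Proof. by rewrite /rnorm distrC. Qed.

Lemma ler_rnormD f g : rnorm (f + g) <= rnorm f + rnorm g.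
Proof. by rewrite -lecR rmorphD /= -!rnormE ler_normD. Qed.

Lemma ler_rdistD h f g : rnorm (f - g) <= rnorm (f - h) + rnorm (h - g).
Proof. by rewrite -lecR rmorphD /= -!rnormE ler_distD. Qed.

Lemma rinnerDl f g h : rinner (f + g) h = rinner f h + rinner g h.
Proof. by rewrite /rinner linearDl raddfD. Qed.

Lemma rinnerC f g : rinner f g = rinner g f.
Proof.
rewrite /rinner (@hermitian_subproof _ _ _ _ inner f g) /= expr0 mul1r.
by case: (inner g f).
Qed.

Lemma rinnerNl f g : rinner (- f) g = - rinner f g.
Proof. by rewrite /rinner linearNl raddfN. Qed.

Lemma rinnerZl r f g : rinner (r%:C *: f) g = r * rinner f g.
Proof.
rewrite /rinner linearZl_LR /=; case: (inner f g) => a b /=.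
by rewrite mul0r subr0.
Qed.

Lemma rinner_ff f : rinner f f = rnorm f ^+ 2.
Proof. by rewrite /rinner -sqr_norm_inner rnormE -rmorphXn. Qed.

Lemma rinnerDr f g h : rinner f (g + h) = rinner f g + rinner f h.
Proof. by rewrite !(rinnerC f) rinnerDl. Qed.

Lemma rinnerNr f g : rinner f (- g) = - rinner f g.
Proof. by rewrite !(rinnerC f) rinnerNl. Qed.

Lemma rinner_sumr f (I : Type) (s : seq I) (F : I -> H) :
  rinner f (\sum_(i <- s) F i) = \sum_(i <- s) rinner f (F i).
Proof.
elim/big_ind2: _ => // [|g1 r1 g2 r2 <- <-]; last by rewrite rinnerDr.
by rewrite -[0 : H]addr0 -{2}[0 : H]oppr0 rinnerDr rinnerNr subrr.
Qed.

Lemma rnormD_sqr f g :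
  rnorm (f + g) ^+ 2 = rnorm f ^+ 2 + 2 * rinner f g + rnorm g ^+ 2.
Proof.
rewrite -!rinner_ff rinnerDl !rinnerDr (rinnerC g f); ring.
Qed.

(** Cauchy-Schwarz comes from the triangle inequality here: square it and compare with the expansion
    of [rnorm (f + g) ^+ 2]. *)
Lemma rinner_le f g : rinner f g <= rnorm f * rnorm g.
Proof.
have := ler_rnormD f g; have := rnormD_sqr f g.
have := rnorm_ge0 f; have := rnorm_ge0 g; have := rnorm_ge0 (f + g).
nra.
Qed.

Lemma normr_rinner_le f g : `|rinner f g| <= rnorm f * rnorm g.
Proof.
by rewrite ler_norml rinner_le lerNl -rinnerNl -[rnorm f]rnormN rinner_le.
Qed.

Lemma rinner_inj f g : (forall h, rinner h f = rinner h g) -> f = g.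
Proof.
move=> fg; apply/eqP; rewrite -subr_eq0; apply/eqP/rnorm_eq0/eqP.
by rewrite -sqrf_eq0 -rinner_ff rinnerDr rinnerNr fg subrr.
Qed.

(** The real part at ['i *: f] is minus the imaginary part at [f], so real parts determine a
    complex-linear functional. *)
Lemma eq_scalar_Re (p q : H -> R[i]) : scalar p -> scalar q ->
  (forall f, complex.Re (p f) = complex.Re (q f)) -> p =1 q.
Proof.
move=> lp lq pq f.
have hi (s : H -> R[i]) : scalar s -> s ('i *: f) = 'i * s f.
  move=> ls; have s0 : s 0 = 0.
    by apply: (addrI (s 0)); rewrite -{2}[s 0]mul1r addrC -ls scale1r !addr0.
  by rewrite -[_ *: _]addr0 ls s0 addr0.
have := pq ('i *: f); rewrite (hi p) // (hi q) //.
move: (pq f); case: (p f) => a b; case: (q f) => c d /= -> /eqP.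
by rewrite !mul0r !mul1r !sub0r eqr_opp => /eqP ->.
Qed.

Lemma hilbert_cauchy (F : set_system H) : ProperFilter F ->
  (forall e : R, 0 < e ->
     exists2 A, F A & forall f g, A f -> A g -> rnorm (f - g) <= e) ->
  cvg F.
Proof.
move=> FF cF; apply/cauchy_cvgP/cauchy_ballP => _/posnumP[e].
(* A positive element of [R[i]] is real; half of it is a real tolerance strictly below it. *)
have [d d0 de] : exists2 d : R, 0 < d & d%:C < e%:num.
  have := [gt0 of e%:num]; case: e%:num => a b; rewrite ltcE /= => /andP[/eqP -> a0].
  by exists (a / 2); rewrite ?divr_gt0// ltcE /= eqxx /= ltr_pdivrMr// ltr_pMr// ltr1n.
have [A FA dA] := cF _ d0.
exists (A, A) => //= -[f g] /= [Af Ag].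
by rewrite -ball_normE /ball_ /= (le_lt_trans _ de) // rnormE lecR dA.
Qed.

Lemma hilbert_cvgP (F : set_system H) (f : H) : Filter F -> F --> f ->
  forall e : R, 0 < e -> F [set g | rnorm (g - f) < e].
Proof.
move=> FF /cvgrPdist_lt Ff e e0.
have := Ff e%:C; rewrite ltcR => /(_ e0).
by apply: filterS => g /=; rewrite rnormE ltcR rdistC.
Qed.

End real_inner.


(** * Lax-Milgram for symmetric coercive real forms *)

Section coercive_form.
Context {R : realType} {H : hilbertType R}.
Implicit Types (f g h : H) (r : R).
Variable a : H -> H -> R.
Hypothesis aC : forall f g, a f g = a g f.
Hypothesis aD : forall f g h, a (f + g) h = a f h + a g h.
Hypothesis aZ : forall r f g, a (r%:C *: f) g = r * a f g.
Variables B c : R.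
Hypothesis c_gt0 : 0 < c.
Hypothesis a_le : forall f g, `|a f g| <= B * (rnorm f * rnorm g).
Hypothesis a_ge : forall f, c * rnorm f ^+ 2 <= a f f.

(* Minimize the quadratic functional Q f = a f f - 2 p f: by the parallelogram
   identity its almost minimizers form a Cauchy filter, whose limit is a
   critical point. *)
Lemma coercive_representation (p : H -> R) (C : R) :
  (forall f g, p (f + g) = p f + p g) ->
  (forall r f, p (r%:C *: f) = r * p f) ->
  (forall f, p f <= C * rnorm f) ->
  exists h, forall f, a f h = p f.
Proof.
move=> pD pZ p_le.
pose Q f := a f f - 2 * p f.
have aDr f g h : a f (g + h) = a f g + a f h by rewrite !(aC f) aD.
have aZr r f g : a f (r%:C *: g) = r * a f g by rewrite !(aC f) aZ.
pose E := [set x | exists f, x = Q f].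
have E_lb : has_inf E.
  split; first by exists (Q 0), 0.
  (* This is the minimum of [c * t ^+ 2 - 2 * C * t] over real [t], found by completing the
     square. *)
  exists (- (C ^+ 2 / c)) => _ [f ->]; rewrite /Q.
  have := p_le f; have := a_ge f.
  have : 0 <= (c * rnorm f - C) ^+ 2 / c by rewrite divr_ge0 ?sqr_ge0 ?ltW.
  have -> : (c * rnorm f - C) ^+ 2 / c = c * rnorm f ^+ 2 - 2 * C * rnorm f + C ^+ 2 / c.
    by field; rewrite gt_eqF.
  nra.
pose d := inf E.
have Qd f : d <= Q f by apply: ge_inf; [case: E_lb | exists f].
pose A e := [set f | Q f < d + e].
have A_ex e : 0 < e -> exists f, A e f.
  move=> e0; have [_ [f ->] Qf] := inf_adherent e0 E_lb.
  by exists f.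
have QB f t g : Q (f + t%:C *: g) = Q f + 2 * t * (a g f - p g) + t ^+ 2 * a g g.
  rewrite /Q !aD !aDr !aZ !aZr pD pZ (aC f g); ring.
have A_close e f g : A e f -> A e g -> c * rnorm (f - g) ^+ 2 <= 4 * e.
  rewrite /A /= => Af Ag; apply: le_trans (a_ge _) _.
  (* The parallelogram identity in disguise: [Q] is compared at [g], at the midpoint and, for
     parameter 1, at [f]; the midpoint value is at least [d]. *)
  have := Qd (g + (2^-1)%:C *: (f - g)); rewrite QB => dm.
  have : Q (g + (1 : R)%:C *: (f - g)) < d + e by rewrite scale1r addrC subrK.
  rewrite QB; move: (a (f - g) g - p (f - g)) (a (f - g) (f - g)) dm => x y.
  lra.
pose F := filter_from [set e : R | 0 < e] A.
have FF : ProperFilter F.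
  apply: filter_from_proper; last by move=> e; exact: A_ex.
  apply: filter_from_filter; first by exists 1 => /=.
  move=> i j /= i0 j0; exists (Num.min i j); first by rewrite /= lt_min i0 j0.
  move=> f; rewrite /A /= => Qf; split; apply: lt_le_trans Qf _;
    by rewrite lerD2l ge_min lexx ?orbT.
have Fcvg : cvg F.
  apply: hilbert_cauchy => e e0; exists (A (c * e ^+ 2 / 4)).
    by exists (c * e ^+ 2 / 4) => //=; rewrite divr_gt0 // mulr_gt0 // exprn_gt0.
  move=> f g Af Ag; have := A_close _ _ _ Af Ag.
  have -> : 4 * (c * e ^+ 2 / 4) = c * e ^+ 2 by field.
  rewrite ler_pM2l // ler_sqr ?nnegrE ?rnorm_ge0 ?(ltW e0) //; apply.
have [h Fh] : exists h, F --> h by exists (lim F); exact: Fcvg.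
exists h => f; apply/eqP; rewrite -subr_eq0 -normr_le0; apply/ler_addgt0Pr => e e0.
rewrite add0r.
have B0 : 0 <= `|B| * rnorm f by rewrite mulr_ge0 // rnorm_ge0.
have af0 : 0 <= a f f.
  by apply: le_trans (a_ge f); rewrite mulr_ge0 ?exprn_ge0 ?rnorm_ge0 // ltW.
(* [d1] controls [a f (h - g)] by boundedness of the form, [d2] controls [a f g - p f] by almost
   minimality of [g]. The added 1 keeps the denominators positive when [f] is 0. *)
pose d1 := e / 2 / (`|B| * rnorm f + 1).
have d10 : 0 < d1 by rewrite !divr_gt0 // ltr_wpDl.
pose d2 := (e / 2) ^+ 2 / (a f f + 1).
have d20 : 0 < d2 by rewrite divr_gt0 ?exprn_gt0 ?divr_gt0 // ltr_wpDl.
have [g [gh Ag]] : exists g, (rnorm (g - h) < d1) /\ A d2 g.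
  apply: (@filter_ex _ F); apply: filterI; first exact: hilbert_cvgP.
  by exists d2.
have -> : a f h - p f = a f (h - g) + (a f g - p f).
  by rewrite addrA -aDr subrK.
rewrite (le_trans (ler_normD _ _)) // [leRHS]splitr lerD //.
  apply: le_trans (a_le _ _) _; rewrite rdistC.
  apply: le_trans (_ : (`|B| * rnorm f + 1) * d1 <= _); last first.
    by rewrite /d1 mulrC divfK // gt_eqF // ltr_wpDl.
  apply: le_trans (_ : `|B| * rnorm f * rnorm (g - h) <= _).
    by rewrite mulrA !ler_wpM2r ?rnorm_ge0 ?ler_norm.
  by rewrite ler_pM ?rnorm_ge0 ?(ltW gh) // lerDl.
set D := a f g - p f.
have s1 : 0 < a f f + 1 by rewrite ltr_wpDl.
(* This move along [f] lowers [Q] by at least [D ^+ 2 / (a f f + 1)], whereas [Q g] exceeds the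
   infimum by less than [d2]. *)
have := Qd (g + (- (D / (a f f + 1)))%:C *: f); rewrite QB -/D => dQ.
rewrite -ler_sqr ?nnegrE ?divr_ge0 ?(ltW e0) // real_normK ?num_real //.
rewrite -(ler_pM2r (_ : 0 < (a f f + 1)^-1)) ?invr_gt0 // -/d2.
have -> : D ^+ 2 / (a f f + 1) =
    2 * D ^+ 2 / (a f f + 1) - D ^+ 2 / (a f f + 1) ^+ 2 * (a f f + 1).
  by field; rewrite gt_eqF.
have : 0 <= D ^+ 2 / (a f f + 1) ^+ 2 by rewrite divr_ge0 ?sqr_ge0.
move: dQ Ag; rewrite /A /= sqrrN expr_div_n mulrN mulNr -mulrA.
have -> : 2 * D ^+ 2 / (a f f + 1) = 2 * (D / (a f f + 1) * D) by ring.
move: (D ^+ 2 / (a f f + 1) ^+ 2) (D / (a f f + 1) * D) => x y.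
lra.
Qed.
End coercive_form.

(** * Bounded linear maps, Riesz representation and adjoints *)

Section bounded_linear_theory.
Context {R : realType} {H K : hilbertType R}.
Implicit Types (T : H -> K).

Lemma bounded_linearD T f g : bounded_linear T -> T (f + g) = T f + T g.
Proof. by move=> [lT _]; rewrite -[f]scale1r lT !scale1r. Qed.

Lemma bounded_linear0 T : bounded_linear T -> T 0 = 0.
Proof. by move=> bT; apply: (addrI (T 0)); rewrite -bounded_linearD // !addr0. Qed.

Lemma bounded_linearZ T c f : bounded_linear T -> T (c *: f) = c *: T f.
Proof.
by move=> bT; rewrite -[c *: f]addr0 (proj1 bT) (bounded_linear0 bT) addr0.
Qed.

Lemma bounded_linearN T f : bounded_linear T -> T (- f) = - T f.
Proof. by move=> bT; rewrite -scaleN1r bounded_linearZ // scaleN1r. Qed.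

Lemma bounded_linear_bound T : bounded_linear T ->
  exists2 C : R, 0 < C & forall f, rnorm (T f) <= C * rnorm f.
Proof.
move=> [_ [C TC]]; exists (`|C| + 1); first by rewrite ltr_wpDl.
move=> f; apply: le_trans (TC f) _; rewrite ler_wpM2r ?rnorm_ge0 //.
by rewrite (le_trans (ler_norm C)) // lerDl.
Qed.

(** Riesz: Lax-Milgram for [rinner] represents the real part of the functional [inner (T f) g] of
    [f], and complex linearity lifts this to [inner]. Hence [xget] never returns its default for
    bounded linear [T]. *)
Lemma adjointP T f g : bounded_linear T -> inner (T f) g = inner f (adjoint T g).
Proof.
move=> bT; have [C C0 TC] := bounded_linear_bound bT.
suff [h Th] : exists h, forall f, inner (T f) g = inner f h.
  by rewrite /adjoint; have /(_ f) := @xgetPex _ 0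
    [set h : H | forall f, inner (T f) g = inner f h] (ex_intro _ h Th).
have [] := @coercive_representation R H rinner (@rinnerC _ _) (@rinnerDl _ _)
   (@rinnerZl _ _) 1 1 ltr01 _ _ (fun f => rinner (T f) g) (C * rnorm g).
- by move=> u v; rewrite mul1r normr_rinner_le.
- by move=> u; rewrite mul1r rinner_ff.
- by move=> u v; rewrite bounded_linearD // rinnerDl.
- by move=> r u; rewrite bounded_linearZ // rinnerZl.
- move=> u; apply: le_trans (rinner_le _ _) _.
  by rewrite mulrAC ler_wpM2r ?rnorm_ge0.
move=> h Th; exists h; apply: eq_scalar_Re => [r u v|r u v|u].
- by rewrite (proj1 bT) linearPl.
- by rewrite linearPl.
- by rewrite -[LHS]/(rinner (T u) g) -Th.
Qed.

Lemma rinner_adjoint T f g : bounded_linear T ->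
  rinner (T f) g = rinner f (adjoint T g).
Proof. by move=> bT; rewrite /rinner adjointP. Qed.

Lemma inner_inj (f g : H) : (forall h, inner h f = inner h g) -> f = g.
Proof. by move=> fg; apply: rinner_inj => h; rewrite /rinner fg. Qed.

Lemma adjoint_linear T : bounded_linear T -> linear (adjoint T).
Proof.
move=> bT c f g; apply: inner_inj => h.
rewrite -adjointP // linearPr /= linearPr /=.
by rewrite !adjointP.
Qed.

Lemma adjoint_bounded_linear T : bounded_linear T -> bounded_linear (adjoint T).
Proof.
move=> bT; split; first exact: adjoint_linear.
have [C C0 TC] := bounded_linear_bound bT; exists C => g.
have := rnorm_ge0 (adjoint T g); rewrite le_eqVlt => /orP[/eqP <-|a0].
  by rewrite mulr_ge0 ?rnorm_ge0 // ltW.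
(* The squared norm of [adjoint T g] equals [rinner (T (adjoint T g)) g]; one factor cancels. *)
rewrite -(ler_pM2l a0) -expr2 -rinner_ff -rinner_adjoint //.
apply: le_trans (rinner_le _ _) _; rewrite mulrCA mulrA.
by rewrite ler_wpM2r ?rnorm_ge0.
Qed.

End bounded_linear_theory.

(** * Uniform boundedness principle *)

Section uniform_boundedness.
Context {R : realType} {H : hilbertType R}.

(** Besides convergence, the explicit tail bound survives in the limit; the gliding hump needs this
    quantitative form. *)
Lemma hilbert_seq_cvg (x : nat -> H) (b : nat -> R) :
  (forall n k, rnorm (x (n + k)%N - x n) <= b n) ->
  (forall e : R, 0 < e -> exists n, b n <= e) ->
  exists l, forall n, rnorm (l - x n) <= b n.
Proof.
move=> xb b0.
have cx : cvg (x @ \oo).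
  apply: hilbert_cauchy => e e0; have [n bn] := b0 _ (divr_gt0 e0 (ltr0n R 2)).
  exists [set f | rnorm (f - x n) <= b n].
    by exists n => // m /= nm; rewrite -(subnKC nm).
  move=> f g /= fx gx; apply: le_trans (ler_rdistD (x n) _ _) _.
  by rewrite (rdistC _ g) [leRHS]splitr lerD // (le_trans _ bn).
exists (lim (x @ \oo)) => n; apply/ler_addgt0Pr => e e0.
have [m [mx nm]] : exists m, rnorm (x m - lim (x @ \oo)) < e /\ (n <= m)%N.
  apply: (@filter_ex _ \oo); apply: filterI; last by exists n.
  exact: (@hilbert_cvgP _ _ (x @ \oo) (lim (x @ \oo)) _ cx).
apply: le_trans (ler_rdistD (x m) _ _) _.
rewrite addrC; apply: lerD; first by rewrite -(subnKC nm).
by rewrite rdistC ltW.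
Qed.

(* Sokal's gliding hump argument: moving by 3^-n in the direction of an element
   y_n of Y with huge norm makes the inner product with y_n large, and the
   later moves are too small to cancel it. *)
Lemma hilbert_uniform_boundedness (Y : set H) :
  (forall x, exists M : R, forall y, Y y -> `|rinner x y| <= M) ->
  exists2 C : R, 0 < C & forall y, Y y -> rnorm y <= C.
Proof.
move=> ptY; apply: contrapT => /forall2NP nY.
(* Step [n] gains at least [3 ^- n * rnorm (y n)] and later moves cancel at most half of it. This
   growth leaves at least [n]. *)
have /choice[y Yy] : forall n, exists y, Y y /\ 2 * n%:R * 3 ^+ n < rnorm y.
  move=> n; have [] := nY (2 * n%:R * 3 ^+ n + 1).
    by move=> /negP; rewrite -leNgt leNgt ltr_wpDl ?mulr_ge0 ?exprn_ge0.
  move=> /existsNP[y /not_implyP[Yy /negP]]; rewrite -ltNge => yn.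
  by exists y; split => //; apply: lt_trans yn; rewrite ltrDl.
(* The sign makes the new contribution reinforce the current inner product; the value at 0 must be
   nonzero so that the move still happens. *)
pose s (f g : H) : R := if 0 <= rinner f g then 1 else -1.
have s1 f g : `|s f g| = 1 by rewrite /s; case: ifP; rewrite ?normrN normr1.
have ss f g : s f g * rinner f g = `|rinner f g|.
  rewrite /s; case: ifPn; first by move=> ?; rewrite mul1r ger0_norm.
  by rewrite -ltNge => /ltr0_norm ->; rewrite mulN1r.
pose v n : R := (3 ^- n / rnorm (y n)).
pose x := fix x n := if n is m.+1 then x m + (s (x m) (y m) * v m)%:C *: y m else 0.
have y0 n : 0 < rnorm (y n).
  by apply: le_lt_trans (proj2 (Yy n)); rewrite !mulr_ge0 ?exprn_ge0.
have v0 n : 0 < v n by rewrite divr_gt0 // invr_gt0 exprn_gt0.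
have dx n : rnorm (x n.+1 - x n) <= 3 ^- n.
  rewrite /= addrC addKr rnormZr normrM s1 mul1r gtr0_norm //.
  by rewrite divfK // gt_eqF.
(* The tail of the geometric series, the sum of [3 ^- k] over [k >= n]; in particular [b n.+1] is
   half of [3 ^- n]. *)
pose b n : R := 3 / 2 * 3 ^- n.
have [l lx] : exists l, forall n, rnorm (l - x n) <= b n.
  apply: hilbert_seq_cvg => [n k|e e0].
    (* The sharper bound telescopes, because [b n - b n.+1] is exactly [3 ^- n]. *)
    suff : rnorm (x (n + k)%N - x n) <= b n - b (n + k)%N.
      move/le_trans; apply; by rewrite gerBl mulr_ge0.
    elim: k => [|k IH]; first by rewrite addn0 !subrr rnorm0.
    apply: le_trans (ler_rdistD (x (n + k)%N) _ _) _; rewrite addnS.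
    apply: le_trans (lerD (dx _) IH) _; rewrite /b exprS.
    rewrite le_eqVlt; apply/orP; left; apply/eqP; field.
    by rewrite !expf_neq0.
  have [n en] : exists n : nat, 3 / 2 / e <= n%:R.
    by exists (Num.truncn (3 / 2 / e)).+1; rewrite ltW // Num.Theory.truncnS_gt.
  exists n; rewrite /b ler_pdivrMr ?exprn_gt0 // -ler_pdivrMl // mulrC.
  apply: le_trans en _; rewrite -natrX ler_nat.
  by rewrite ltnW // ltn_expl.
have [M lM] := ptY l.
pose n := (Num.truncn M).+1.
have := lM (y n) (proj1 (Yy n)); apply/negP; rewrite -ltNge.
have Mn : M < n%:R by rewrite Num.Theory.truncnS_gt.
apply: lt_le_trans Mn _.
have -> : l = x n.+1 + (l - x n.+1) by rewrite addrC subrK.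
have xy : 3 ^- n * rnorm (y n) <= `|rinner (x n.+1) (y n)|.
  apply: le_trans (_ : s (x n) (y n) * rinner (x n.+1) (y n) <= _).
    rewrite /= rinnerDl rinnerZl rinner_ff mulrDr ss mulrA mulrA.
    have -> : s (x n) (y n) * s (x n) (y n) = 1.
      by rewrite /s; case: ifP; rewrite ?mulrNN mulr1.
    by rewrite mul1r /v expr2 mulrA divfK ?gt_eqF // lerDr.
  by apply: le_trans (ler_norm _) _; rewrite normrM s1 mul1r.
have ly : `|rinner (l - x n.+1) (y n)| <= 2^-1 * (3 ^- n * rnorm (y n)).
  apply: le_trans (normr_rinner_le _ _) _; rewrite mulrA.
  rewrite ler_wpM2r ?rnorm_ge0 // (le_trans (lx _)) // /b exprS invfM.
  by rewrite le_eqVlt; apply/orP; left; apply/eqP; field; rewrite expf_neq0.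
have ny : 2 * n%:R <= 3 ^- n * rnorm (y n).
  by rewrite [leRHS]mulrC ler_pdivlMr ?exprn_gt0 // ltW // (proj2 (Yy n)).
rewrite rinnerDl; move: xy ly ny; move: (3 ^- n * _) => z xy ly ny.
apply: le_trans (lerB_normD _ _); lra.
Qed.

End uniform_boundedness.

(** * Bounded inverses of bijective operators *)

Section inverse_theory.
Context {R : realType} {H : hilbertType R}.
Implicit Type G : H -> H.

Lemma inverseK G : bijective G -> cancel G (inverse G) /\ cancel (inverse G) G.
Proof.
move=> bG; have [g GK gK] := bG; split=> f.
  by apply: pinvKV; rewrite ?inE // => u v _ _; exact: (can_inj GK).
by apply: pinvK; rewrite inE; exists (g f).
Qed.

Lemma bounded_below_inj G (c : R) : bounded_linear G -> 0 < c ->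
  (forall f, c * rnorm f <= rnorm (G f)) -> injective G.
Proof.
move=> bG c0 Gc f g fg; apply/eqP; rewrite -subr_eq0; apply/eqP/rnorm_eq0/eqP.
rewrite eq_le rnorm_ge0 andbT -(ler_pM2l c0) mulr0 (le_trans (Gc _)) //.
by rewrite bounded_linearD // bounded_linearN // fg subrr rnorm0.
Qed.

Lemma bounded_below_inverse G (c : R) : bounded_linear G -> bijective G ->
  0 < c -> (forall f, c * rnorm f <= rnorm (G f)) -> invertible G.
Proof.
move=> bG jG c0 Gc; split=> //; have [GK gK] := inverseK jG; split.
  by move=> r f g; apply: (can_inj GK); rewrite (proj1 bG) !gK.
by exists c^-1 => f; rewrite mulrC ler_pdivlMr // mulrC -{2}(gK f) Gc.
Qed.

(* The set of all y with |G* y| <= 1 is pointwise bounded because G is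
   surjective, so G* is bounded below and G G* is coercive, hence onto. *)
Lemma bijective_bounded_below G : bounded_linear G -> bijective G ->
  exists2 c : R, 0 < c & forall f, c * rnorm f <= rnorm (G f).
Proof.
move=> bG jG; have [GK gK] := inverseK jG.
pose G' := adjoint G; have bG' : bounded_linear G' := adjoint_bounded_linear bG.
have [|C C0 YC] := @hilbert_uniform_boundedness R H [set y | rnorm (G' y) <= 1].
  (* Moving [G] across in [rinner (G (inverse G x)) y] leaves [G' y], of norm at most 1. *)
  move=> x; exists (rnorm (inverse G x)) => y /= y1.
  rewrite -{1}(gK x) rinner_adjoint // (le_trans (normr_rinner_le _ _)) //.
  by rewrite -[leRHS]mulr1 ler_wpM2l ?rnorm_ge0.
have G'C y : rnorm y <= C * rnorm (G' y).
  (* Scaling [y] into the set divides by [rnorm (G' y)], possibly 0 at this point; [e] keeps the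
     divisor positive. *)
  rewrite mulrC -ler_pdivrMr //; apply/ler_addgt0Pr => e e0.
  have r0 : 0 < rnorm (G' y) + e by rewrite ltr_wpDl ?rnorm_ge0.
  rewrite ler_pdivrMr // mulrC -ler_pdivrMr //.
  have := YC ((rnorm (G' y) + e)^-1%:C *: y).
  rewrite /= bounded_linearZ // !rnormZr gtr0_norm ?invr_gt0 // !(mulrC _^-1); apply.
  by rewrite ler_pdivrMr // mul1r lerDl ltW.
exists C^-1; first by rewrite invr_gt0.
move=> f; rewrite mulrC ler_pdivrMr // mulrC.
have [D D0 G'D] := bounded_linear_bound bG'.
(* This is the form of [G G*]. Representing [G f] gives [z] with [G (G' z) = G f], hence
   [f = G' z]. *)
have [] := @coercive_representation R H (fun u v => rinner (G' u) (G' v))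
  (fun _ _ => rinnerC _ _) _ _ (D ^+ 2) (C ^- 2) _ _ _
  (fun u => rinner u (G f)) (rnorm (G f)).
- by move=> u v w; rewrite bounded_linearD // rinnerDl.
- by move=> r u v; rewrite bounded_linearZ // rinnerZl.
- by rewrite invr_gt0 exprn_gt0.
- move=> u v; rewrite (le_trans (normr_rinner_le _ _)) // expr2 mulrACA.
  by rewrite ler_pM ?rnorm_ge0.
- move=> u; rewrite rinner_ff mulrC ler_pdivrMr ?exprn_gt0 // -exprMn mulrC.
  by rewrite ler_sqr ?nnegrE ?mulr_ge0 ?rnorm_ge0 // ltW.
- by move=> u v; rewrite rinnerDl.
- by move=> r u; rewrite rinnerZl.
- by move=> u; rewrite mulrC rinner_le.
move=> z zf.
have fE : f = G' z.
  apply: (can_inj GK); apply: rinner_inj => u.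
  by rewrite -zf [RHS]rinnerC (rinner_adjoint (G' z) u bG) rinnerC.
have := rnorm_ge0 f; rewrite le_eqVlt => /orP[/eqP <-|f0].
  by rewrite mulr_ge0 ?rnorm_ge0 // ltW.
rewrite -(ler_pM2r f0) -expr2 -rinner_ff {1 2}fE zf.
apply: le_trans (rinner_le _ _) _; rewrite -mulrA mulrCA mulrC.
by rewrite ler_wpM2l ?rnorm_ge0 // fE G'C.
Qed.

Lemma invertible_bijective G : bounded_linear G -> bijective G -> invertible G.
Proof.
move=> bG jG; have [c c0 Gc] := bijective_bounded_below bG jG.
exact: bounded_below_inverse Gc.
Qed.

End inverse_theory.

(** * Finite partial sums and sums in the extended reals *)

Lemma big_fset_subset (V : nmodType) (I : choiceType) (A B : {fset I}) (F : I -> V) :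
  (A `<=` B)%fset ->
  \sum_(i <- B) F i = \sum_(i <- A) F i + \sum_(i <- (B `\` A)%fset) F i.
Proof.
move=> /fsubsetP AB; rewrite (big_fsetID _ (mem A)) /=; congr +%R;
  congr (\big[_/_]_(i <- enum_fset _) _); apply/fsetP => i; rewrite !inE /=.
  by apply/andP/idP => [[]//|iA]; rewrite AB.
by rewrite andbC.
Qed.

Lemma ler_sum_fset (R : numDomainType) (I : choiceType) (A B : {fset I}) (x : I -> R) :
  (forall i, 0 <= x i) -> (A `<=` B)%fset ->
  \sum_(i <- A) x i <= \sum_(i <- B) x i.
Proof.
by move=> x0 AB; rewrite (big_fset_subset _ AB) lerDl sumr_ge0.
Qed.

(** The sum is the supremum of its finite subsums. This moves the frame inequalities from extended
    reals to finite real sums. *)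
Lemma esum_boundsP (R : realType) (I : choiceType) (x : I -> R) (L U : R) :
  (forall i, 0 <= x i) ->
  (L%:E <= \esum_(i in [set: I]) (x i)%:E <= U%:E)%E <->
  (forall A : {fset I}, \sum_(i <- A) x i <= U) /\
  (forall e, 0 < e -> exists A : {fset I}, L - e < \sum_(i <- A) x i).
Proof.
move=> x0; set s := (\esum_(i in _) _)%E.
have les (A : {fset I}) : ((\sum_(i <- A) x i)%:E <= s)%E.
  apply: ereal_sup_ubound => /=; exists [set` A]; first by split.
  by rewrite -fsbig_seq ?fset_uniq // sumEFin.
split=> [/andP[Ls sU]|[xU xL]].
  split=> [A|e e0]; first by rewrite -lee_fin (le_trans (les A)).
  have : ((L - e)%:E < s)%E by rewrite (lt_le_trans _ Ls) // lte_fin gtrBl.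
  move=> /ereal_sup_gt[_ /= [A [fA _] <-]].
  by rewrite fsbig_finite // sumEFin lte_fin; exists (fset_set A).
have sU : (s <= U%:E)%E.
  apply: ge_ereal_sup => _ [A [fA _] <-].
  by rewrite fsbig_finite // sumEFin lee_fin.
rewrite sU andbT leNgt; apply/negP.
have s0 : (0 <= s)%E by apply: esum_ge0 => i _; rewrite lee_fin.
case: s s0 sU les => // r _ _ les; rewrite lte_fin -subr_gt0 => rL.
(* If the sum [r] were below [L], the tolerance [L - r] would give a finite subsum exceeding [r]. *)
have [A] := xL _ rL; apply/negP; rewrite -leNgt subKr.
by have := les A; rewrite lee_fin.
Qed.

#[local] Existing Instance summability.totally_filter.

(** * The frame operator: convergence, symmetry, coercivity, invertibility *)

Section frame_operator.
Context {R : realType} {J : set int} {H : hilbertType R} {K : J -> hilbertType R}.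
Variables (Lambda : forall i : J, H -> K i) (A B : R).
Hypotheses (A_gt0 : 0 < A) (B_gt0 : 0 < B).
Hypothesis Lambda_lin : forall i, bounded_linear (Lambda i).
Implicit Types (f g : H) (F : {fset J}).

Let sqr f (i : J) : R := rnorm (Lambda i f) ^+ 2.
Let term f (i : J) : H := adjoint (Lambda i) (Lambda i f).
Let psum f F : H := \sum_(i <- F) term f i.

Hypothesis frame_le : forall f F, \sum_(i <- F) sqr f i <= B * rnorm f ^+ 2.
Hypothesis frame_ge : forall f e, 0 < e ->
  exists F, A * rnorm f ^+ 2 - e < \sum_(i <- F) sqr f i.

Let frame_sqr_ge0 f i : 0 <= sqr f i. Proof. by rewrite exprn_ge0 // rnorm_ge0. Qed.

Lemma rinner_psum f g F :
  rinner (psum f F) g = \sum_(i <- F) rinner (Lambda i f) (Lambda i g).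
Proof.
rewrite rinnerC rinner_sumr; apply: eq_bigr => i _.
by rewrite -rinner_adjoint // rinnerC.
Qed.

(** For [g := psum f F], expand [rinner g g] termwise and use [2uv <= B u^2 + v^2 / B]. The upper
    frame bound for [g] absorbs the second sum into one copy of [rnorm g ^+ 2]. *)
Lemma rnorm_psum_sqr f F : rnorm (psum f F) ^+ 2 <= B * \sum_(i <- F) sqr f i.
Proof.
set g := psum f F.
have : 2 * rnorm g ^+ 2 <= B * \sum_(i <- F) sqr f i + (\sum_(i <- F) sqr g i) / B.
  rewrite -rinner_ff rinner_psum !mulr_sumr mulr_suml -big_split /=.
  apply: ler_sum => i _; rewrite /sqr.
  have := rinner_le (Lambda i f) (Lambda i g).
  set u := rnorm (Lambda i f); set v := rnorm (Lambda i g).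
  have : 0 <= (B * u - v) ^+ 2 / B by rewrite divr_ge0 ?sqr_ge0 // ltW.
  have -> : (B * u - v) ^+ 2 / B = B * u ^+ 2 + v ^+ 2 / B - 2 * (u * v).
    by field; rewrite gt_eqF.
  lra.
have : (\sum_(i <- F) sqr g i) / B <= rnorm g ^+ 2.
  by rewrite ler_pdivrMr // mulrC.
lra.
Qed.

Lemma frame_partial_sumE f :
  summability.partial_sum (term f) = psum f.
Proof. by apply/funext => F; rewrite /psum big_seq_fsetE. Qed.

Lemma frame_operator_converges f :
  cvg (summability.partial_sum (term f) @ summability.totally).
Proof.
rewrite frame_partial_sumE.
apply: hilbert_cauchy => e e0.
pose E := [set x | exists F, x = \sum_(i <- F) sqr f i].
have supE : has_sup E.
  split; first by exists (\sum_(i <- fset0) sqr f i), fset0.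
  by exists (B * rnorm f ^+ 2) => _ [F ->].
(* Beyond [F0] the subsums of squares grow by less than this, so [rnorm_psum_sqr] bounds the
   increment of [psum] by [e / 2]. *)
have h0 : 0 < (e / 2) ^+ 2 / B by rewrite divr_gt0 // exprn_gt0 // divr_gt0.
have [_ [F0 ->] F0E] := sup_adherent h0 supE.
have close F : (F0 `<=` F)%fset -> rnorm (psum f F - psum f F0) <= e / 2.
  move=> F0F; rewrite /psum (big_fset_subset _ F0F) addrC addKr.
  rewrite -ler_sqr ?nnegrE ?rnorm_ge0 ?divr_ge0 ?(ltW e0) //.
  apply: le_trans (rnorm_psum_sqr _ _) _.
  rewrite mulrC -ler_pdivlMr //.
  have : \sum_(i <- F) sqr f i <= sup E by apply: ub_le_sup; [case: supE|exists F].
  rewrite (big_fset_subset _ F0F); lra.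
exists [set g | rnorm (g - psum f F0) <= e / 2].
  by exists F0 => // F; exact: close.
move=> g h /= gF hF; apply: le_trans (ler_rdistD (psum f F0) _ _) _.
by rewrite (rdistC _ h) [leRHS]splitr lerD.
Qed.

Lemma frame_operator_approx f (e : R) : 0 < e ->
  exists F0, forall F, (F0 `<=` F)%fset ->
    rnorm (psum f F - gframe_operator Lambda f) < e.
Proof.
move=> e0; have cf := @frame_operator_converges f.
have [F0 _ F0e] := hilbert_cvgP _ cf e0.
by exists F0 => F /F0e; rewrite -frame_partial_sumE.
Qed.

Lemma rinner_frame_operator_approx f g (e : R) : 0 < e ->
  exists F0, forall F, (F0 `<=` F)%fset ->
    `|rinner (psum f F) g - rinner (gframe_operator Lambda f) g| < e.
Proof.
move=> e0; have d0 : 0 < e / (rnorm g + 1) by rewrite divr_gt0 // ltr_wpDl ?rnorm_ge0.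
have [F0 F0e] := @frame_operator_approx f _ d0; exists F0 => F /F0e.
rewrite ltr_pdivlMr ?ltr_wpDl ?rnorm_ge0 // => Fe.
rewrite -rinnerNl -rinnerDl (le_lt_trans (normr_rinner_le _ _)) //.
by rewrite (le_lt_trans _ Fe) // ler_wpM2l ?rnorm_ge0 // lerDl.
Qed.

Lemma frame_operator_linear : linear (gframe_operator Lambda).
Proof.
move=> c f g; apply: cvg_lim => //; rewrite -/(term (c *: f + g)).
have -> : summability.partial_sum (term (c *: f + g)) =
    (fun F => c *: summability.partial_sum (term f) F
              + summability.partial_sum (term g) F).
  apply/funext => F; rewrite !frame_partial_sumE /psum scaler_sumr -big_split /=.
  apply: eq_bigr => i _; rewrite /term (proj1 (Lambda_lin i)).
  by rewrite (adjoint_linear (Lambda_lin i)).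
apply: cvgD; last exact: frame_operator_converges.
by apply: cvgZl_tmp; exact: frame_operator_converges.
Qed.

Lemma frame_operator_bounded f : rnorm (gframe_operator Lambda f) <= B * rnorm f.
Proof.
apply/ler_addgt0Pr => e e0; have [F0 F0e] := frame_operator_approx f e0.
have := F0e F0 (fsubset_refl _); set s := psum f F0 => se.
have sB : rnorm s <= B * rnorm f.
  rewrite -ler_sqr ?nnegrE ?mulr_ge0 ?rnorm_ge0 ?(ltW B_gt0) //.
  apply: le_trans (rnorm_psum_sqr _ _) _.
  by rewrite exprMn expr2 -mulrA ler_pM2l.
have := ler_rnormD s (gframe_operator Lambda f - s).
rewrite addrC subrK rdistC; lra.
Qed.

Lemma frame_operator_bounded_linear : bounded_linear (gframe_operator Lambda).
Proof.
split; first exact: frame_operator_linear.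
by exists B => f; exact: frame_operator_bounded.
Qed.

Lemma frame_operator_sym f g :
  rinner (gframe_operator Lambda f) g = rinner (gframe_operator Lambda g) f.
Proof.
apply/eqP; rewrite -subr_eq0 -normr_le0; apply/ler_addgt0Pr => e e0; rewrite add0r.
have e20 : 0 < e / 2 by rewrite divr_gt0.
have [F1 F1e] := rinner_frame_operator_approx f g e20.
have [F2 F2e] := rinner_frame_operator_approx g f e20.
(* The union lies beyond both thresholds, and the finite partial sums are symmetric. *)
have := F1e _ (fsubsetUl F1 F2); have := F2e _ (fsubsetUr F1 F2).
have -> : rinner (psum g (F1 `|` F2)%fset) f = rinner (psum f (F1 `|` F2)%fset) g.
  by rewrite !rinner_psum; apply: eq_bigr => i _; rewrite rinnerC.
move: (rinner (psum f _) g) => s; rewrite !ltr_norml ler_norml; lra.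
Qed.

Lemma frame_operator_coercive f :
  A * rnorm f ^+ 2 <= rinner (gframe_operator Lambda f) f.
Proof.
apply/ler_addgt0Pr => e e0.
have e20 : 0 < e / 2 by rewrite divr_gt0.
have [F1 F1e] := rinner_frame_operator_approx f f e20.
have [F2 F2e] := frame_ge f e20.
have := F1e _ (fsubsetUl F1 F2).
have : \sum_(i <- F2) sqr f i <= rinner (psum f (F1 `|` F2)%fset) f.
  rewrite rinner_psum; under [leRHS]eq_bigr do rewrite rinner_ff.
  by apply: ler_sum_fset; [exact: frame_sqr_ge0|exact: fsubsetUr].
rewrite ltr_norml; lra.
Qed.

Lemma frame_operator_bounded_below f :
  A * rnorm f <= rnorm (gframe_operator Lambda f).
Proof.
have := rnorm_ge0 f; rewrite le_eqVlt => /orP[/eqP <-|f0].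
  by rewrite mulr0 rnorm_ge0.
rewrite -(ler_pM2r f0) -mulrA -expr2.
by apply: le_trans (frame_operator_coercive f) _; exact: rinner_le.
Qed.

(** Lax-Milgram for the form [rinner (S f) g], with [S] the frame operator, yields a preimage of
    each [h]; the lower bound gives injectivity, which turns the right inverse into a two-sided
    one. *)
Lemma frame_operator_bijective : bijective (gframe_operator Lambda).
Proof.
have bS := frame_operator_bounded_linear.
suff /choice[g gK] : forall h, exists f, gframe_operator Lambda f = h.
  exists g => // f; apply: (bounded_below_inj bS A_gt0) => //.
  exact: frame_operator_bounded_below.
move=> h.
have [] := @coercive_representation R H (fun f g => rinner (gframe_operator Lambda f) g)
  frame_operator_sym _ _ B A A_gt0 _ frame_operator_coercive (fun f => rinner f h) (rnorm h).
- by move=> u v w; rewrite bounded_linearD // rinnerDl.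
- by move=> r u v; rewrite bounded_linearZ // rinnerZl.
- move=> u v; rewrite (le_trans (normr_rinner_le _ _)) // mulrA.
  by rewrite ler_wpM2r ?rnorm_ge0 // frame_operator_bounded.
- by move=> u v; rewrite rinnerDl.
- by move=> r u; rewrite rinnerZl.
- by move=> u; rewrite mulrC rinner_le.
move=> f fh; exists f; apply: rinner_inj => u.
by rewrite rinnerC frame_operator_sym fh.
Qed.

Lemma frame_operator_invertible : invertible (gframe_operator Lambda).
Proof.
apply: bounded_below_inverse A_gt0 frame_operator_bounded_below.
  exact: frame_operator_bounded_linear.
exact: frame_operator_bijective.
Qed.

End frame_operator.

(** * Composition and scaling of operators *)

Section bounded_linear_operations.
Context {R : realType} {H K L : hilbertType R}.

Lemma bounded_linear_comp (T : K -> L) (G : H -> K) :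
  bounded_linear T -> bounded_linear G -> bounded_linear (T \o G).
Proof.
move=> bT bG; split; first by move=> c f g; rewrite /= (proj1 bG) (proj1 bT).
have [C C0 TC] := bounded_linear_bound bT.
have [D D0 GD] := bounded_linear_bound bG.
exists (C * D) => f; apply: le_trans (TC _) _.
by rewrite -mulrA ler_pM2l.
Qed.

Lemma bounded_linear_scale (c : R[i]) (T : H -> K) :
  bounded_linear T -> bounded_linear (fun f => c *: T f).
Proof.
move=> bT; split.
  by move=> r f g; rewrite (proj1 bT) scalerDr !scalerA mulrC.
have [C C0 TC] := bounded_linear_bound bT; exists (complex.Re `|c| * C) => f.
by rewrite rnormZ -mulrA ler_wpM2l // -ler0c RRe_real ?normr_real.
Qed.

Lemma adjoint_scale (c : R[i]) (T : H -> K) g : bounded_linear T ->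
  adjoint (fun f => c *: T f) g = Num.conj c *: adjoint T g.
Proof.
move=> bT; apply: inner_inj => h.
rewrite -adjointP; last exact: bounded_linear_scale.
by rewrite linearZl_LR linearZr_LR /= conjCK adjointP.
Qed.

End bounded_linear_operations.

(** * Stability of g-frames and the multiplier as a scaled frame operator *)

Section gframe_theory.
Context {R : realType} {J : set int} {H : hilbertType R} {K : J -> hilbertType R}.
Implicit Types (Lambda : forall i : J, H -> K i) (G : H -> H) (c : J -> R[i]).

Lemma gframeP Lambda : gframe Lambda <->
  (forall i, bounded_linear (Lambda i)) /\
  exists A B : R, [/\ 0 < A, 0 < B & forall f,
    (forall F : {fset J}, \sum_(i <- F) rnorm (Lambda i f) ^+ 2 <= B * rnorm f ^+ 2) /\
    (forall e, 0 < e -> exists F : {fset J},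
       A * rnorm f ^+ 2 - e < \sum_(i <- F) rnorm (Lambda i f) ^+ 2)].
Proof.
split=> -[bL [A [B [A0 B0 AB]]]]; split=> //; exists A, B; split=> // f;
  apply/(esum_boundsP _ _ (fun i => exprn_ge0 2 (rnorm_ge0 (Lambda i f)))); exact: AB.
Qed.

Lemma gframe_operator_cvg Lambda f : gframe Lambda ->
  cvg (summability.partial_sum (fun i : J => adjoint (Lambda i) (Lambda i f))
         @ summability.totally).
Proof.
move=> /gframeP[bL [A [B [A0 B0 AB]]]].
apply: (@frame_operator_converges R J H K Lambda B B0 bL) => g.
by case: (AB g).
Qed.

Lemma gframe_operator_invertible Lambda :
  gframe Lambda -> invertible (gframe_operator Lambda).
Proof.
move=> /gframeP[bL [A [B [A0 B0 AB]]]].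
by apply: (@frame_operator_invertible R J H K Lambda A B A0 B0 bL) => g;
  case: (AB g).
Qed.

Lemma gframe_scaled_family Lambda c (a b : R) : 0 < a ->
  (forall i, a%:C <= `|c i| ^+ 2 <= b%:C) ->
  gframe Lambda -> gframe (scaled_family c Lambda).
Proof.
move=> a0 cab /gframeP[bL [A [B [A0 B0 AB]]]]; apply/gframeP; split.
  by move=> i; exact: bounded_linear_scale.
have cE i f : rnorm (scaled_family c Lambda i f) ^+ 2
    = complex.Re `|c i| ^+ 2 * rnorm (Lambda i f) ^+ 2.
  by rewrite /scaled_family rnormZ exprMn.
have {}cab i : a <= complex.Re `|c i| ^+ 2 <= b.
  have := cab i; have cr : (complex.Re `|c i|)%:C = `|c i|.
    by rewrite RRe_real ?normr_real.
  by rewrite -{1 2}cr -rmorphXn /= !lecR.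
(* For empty [J] nothing forces [b] to be positive; the absolute value and the added 1 secure a
   positive upper bound. *)
exists (a * A), (`|b| * B + 1); split; rewrite ?mulr_gt0 ?ltr_wpDl ?mulr_ge0 ?(ltW B0) //.
move=> f; have [Uf Lf] := AB f; split=> [F|e e0].
  apply: le_trans (_ : `|b| * (B * rnorm f ^+ 2) <= _).
    apply: le_trans (ler_wpM2l (normr_ge0 b) (Uf F)); rewrite mulr_sumr.
    apply: ler_sum => i _; rewrite cE ler_wpM2r ?exprn_ge0 ?rnorm_ge0 //.
    by case/andP: (cab i) => _ /le_trans; apply; exact: ler_norm.
  by rewrite mulrA ler_wpM2r ?exprn_ge0 ?rnorm_ge0 // lerDl.
have [F Fe] := Lf _ (divr_gt0 e0 a0); exists F.
apply: lt_le_trans (_ : a * \sum_(i <- F) rnorm (Lambda i f) ^+ 2 <= _).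
  by rewrite -ltr_pdivrMl // mulrBr -mulrA mulKf ?gt_eqF // (mulrC _ e).
rewrite mulr_sumr; apply: ler_sum => i _.
by rewrite cE ler_wpM2r ?exprn_ge0 ?rnorm_ge0 //; case/andP: (cab i).
Qed.

(** The frame inequalities at [G f] are combined with the upper and lower bounds of [G], the latter
    coming from bijectivity. *)
Lemma gframe_comp_bijective Lambda G : gframe Lambda -> bounded_linear G ->
  bijective G -> gframe (fun i => Lambda i \o G).
Proof.
move=> [bL [A [B [A0 B0 AB]]]] bG jG; split.
  by move=> i; exact: bounded_linear_comp.
have [C C0 GC] := bounded_linear_bound bG.
have [c c0 Gc] := bijective_bounded_below bG jG.
exists (A * c ^+ 2), (B * C ^+ 2); split; rewrite ?mulr_gt0 ?exprn_gt0 //.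
move=> f; have /andP[Al Bu] := AB (G f); apply/andP; split.
  apply: le_trans Al; rewrite lee_fin -mulrA -exprMn ler_pM2l //.
  by rewrite ler_sqr ?nnegrE ?mulr_ge0 ?rnorm_ge0 // ltW.
apply: le_trans Bu _; rewrite lee_fin -mulrA -exprMn ler_pM2l //.
by rewrite ler_sqr ?nnegrE ?mulr_ge0 ?rnorm_ge0 // ltW.
Qed.

(** [c] and [s] cover both sign cases at once: [c i] is a square root of [m i] or of its modulus,
    and [s] is the sign. The adjoint contributes the conjugate of [c i], which completes the squared
    modulus. *)
Lemma gmultiplier_termE Lambda G (m c : J -> R[i]) (s : R[i]) f :
  (forall i, bounded_linear (Lambda i)) -> (forall i, m i = s * `|c i| ^+ 2) ->
  gmultiplier_term m Lambda (fun i => Lambda i \o G) f =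
  fun i => s *: adjoint (scaled_family c Lambda i) (scaled_family c Lambda i (G f)).
Proof.
move=> bL mE; apply/funext => i; rewrite /gmultiplier_term mE /scaled_family /=.
rewrite adjoint_scale // (bounded_linearZ _ _ (adjoint_bounded_linear (bL i))).
by rewrite !scalerA normCK mulrA mulrAC.
Qed.

Lemma gmultiplier_cvg Lambda G (m c : J -> R[i]) (s : R[i]) f :
  gframe Lambda -> gframe (scaled_family c Lambda) ->
  (forall i, m i = s * `|c i| ^+ 2) ->
  summability.partial_sum (gmultiplier_term m Lambda (fun i => Lambda i \o G) f)
    @ summability.totally --> s *: gframe_operator (scaled_family c Lambda) (G f).
Proof.
move=> [bL _] fc mE; rewrite (gmultiplier_termE _ _ bL mE).
pose t i := adjoint (scaled_family c Lambda i) (scaled_family c Lambda i (G f)).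
have -> : summability.partial_sum (fun i => s *: t i) =
          (fun F => s *: summability.partial_sum t F).
  by apply/funext => F; rewrite /summability.partial_sum scaler_sumr.
by apply: cvgZl_tmp; exact: gframe_operator_cvg.
Qed.

End gframe_theory.

(** * Inverting scaled compositions, and the two sign cases of the multiplier *)

Section composition.
Context {R : realType} {H : hilbertType R}.
Implicit Types S G M : H -> H.

Lemma bijective_scale_comp S G M (s : R[i]) : s != 0 ->
  (forall f, M f = s *: S (G f)) -> bijective S -> bijective G -> bijective M.
Proof.
move=> s0 ME [S' SK S'K] [G' GK G'K]; exists (fun f => G' (S' (s^-1 *: f))) => f.
  by rewrite ME scalerA mulVf // scale1r SK GK.
by rewrite ME G'K S'K scalerA mulfV // scale1r.
Qed.

Lemma inverse_eq M f g : bijective M -> M g = f -> inverse M f = g.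
Proof. by move=> /inverseK[MK _] <-; rewrite MK. Qed.

End composition.

Theorem proposition3p3 (R : realType) (J : set int)
    (H : hilbertType R) (K : J -> hilbertType R)
    (Lambda Theta : forall i : J, H -> K i) (G : H -> H) (m : J -> R[i])
    (sepH : separable H) (sepK : forall i, separable (K i))
    (frameLambda : gframe Lambda)
    (linG : bounded_linear G) (bijG : bijective G)
    (ThetaE : forall i, Theta i = Lambda i \o G)
    (semi_m : semi_normalized m)
    (sign_m : positive_seq m \/ negative_seq m) :
  [/\ gframe Theta,
      gmultiplier_converges m Lambda Theta,
      invertible (gmultiplier m Lambda Theta),
      positive_seq m ->
        let Lambda' := scaled_family (fun i => sqrtC (m i)) Lambda in
        gframe Lambda' /\
        forall f, inverse (gmultiplier m Lambda Theta) f
                  = inverse G (inverse (gframe_operator Lambda') f)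
    & negative_seq m ->
        let Lambda' := scaled_family (fun i => sqrtC `|m i|) Lambda in
        gframe Lambda' /\
        forall f, inverse (gmultiplier m Lambda Theta) f
                  = - inverse G (inverse (gframe_operator Lambda') f)].
Proof.
have -> : Theta = (fun i => Lambda i \o G).
  by apply: functional_extensionality_dep => i; exact: ThetaE.
have [a [b [a0 _ mab]]] := semi_m.
have sqrt_sqr (z : R[i]) : `|sqrtC z| ^+ 2 = `|z| by rewrite -normrX sqrtCK.
have frame_pos : gframe (scaled_family (fun i => sqrtC (m i)) Lambda).
  by apply: (gframe_scaled_family a0 _ frameLambda) => i; rewrite sqrt_sqr.
have frame_neg : gframe (scaled_family (fun i => sqrtC `|m i|) Lambda).
  by apply: (gframe_scaled_family a0 _ frameLambda) => i; rewrite sqrt_sqr normr_id.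
have pos_eq : positive_seq m -> forall i, m i = 1 * `|sqrtC (m i)| ^+ 2.
  by move=> m0 i; rewrite sqrt_sqr mul1r gtr0_norm.
have neg_eq : negative_seq m -> forall i, m i = -1 * `|sqrtC `|m i| | ^+ 2.
  by move=> m0 i; rewrite sqrt_sqr normr_id ltr0_norm // mulN1r opprK.
have GK := inverseK bijG.
have mulE c s : gframe (scaled_family c Lambda) -> (forall i, m i = s * `|c i| ^+ 2) ->
    forall f, gmultiplier m Lambda (fun i => Lambda i \o G) f
              = s *: gframe_operator (scaled_family c Lambda) (G f).
  move=> fc mE f; apply: cvg_lim => //.
  exact: (gmultiplier_cvg frameLambda fc mE).
(* Merging the signs lets convergence and invertibility be proved once; only the inverse formulas
   need separate cases. *)
have [c [s [s0 fc mE]]] : exists c s, [/\ s != 0 :> R[i],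
    gframe (scaled_family c Lambda) & forall i, m i = s * `|c i| ^+ 2].
  case: sign_m => [/pos_eq mE|/neg_eq mE].
    by exists (fun i => sqrtC (m i)), 1; rewrite oner_neq0.
  by exists (fun i => sqrtC `|m i|), (-1); rewrite oppr_eq0 oner_neq0.
have ME := mulE _ _ fc mE.
have [bS jS _] := gframe_operator_invertible fc.
have jM := bijective_scale_comp s0 ME jS bijG.
split.
- exact: gframe_comp_bijective.
- by move=> f; apply/cvg_ex; eexists; exact: (gmultiplier_cvg frameLambda fc mE).
(* The bounded inverse comes from applying the uniform boundedness argument to the multiplier
   itself. *)
- apply: invertible_bijective jM.
  have -> : gmultiplier m Lambda (fun i => Lambda i \o G)
      = (fun f => s *: (gframe_operator (scaled_family c Lambda) \o G) f).
    by apply/funext => f; rewrite ME.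
  exact/bounded_linear_scale/bounded_linear_comp.
- move=> /pos_eq mE' L'; split=> // f; apply: inverse_eq => //.
  have [_ jL _] := gframe_operator_invertible frame_pos.
  by rewrite (mulE _ _ frame_pos mE') scale1r (proj2 GK) (proj2 (inverseK jL)).
(* The multiplier is applied to the claimed value; the sign [-1] cancels the minus pulled out of [G]
   and the frame operator. *)
- move=> /neg_eq mE' L'; split=> // f; apply: inverse_eq => //.
  have [bL jL _] := gframe_operator_invertible frame_neg.
  rewrite (mulE _ _ frame_neg mE') bounded_linearN // (proj2 GK).
  by rewrite bounded_linearN // (proj2 (inverseK jL)) scaleN1r opprK.
Qed.
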